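(* Let $(W,S)$ be a right-angled Coxeter system of type $\Gamma$, and let $Y\subseteq S$ be of finite thickness $e\in\mathbb N$. Then one has the iterated (internal) semidirect product decomposition $$K^\circ_Y(\Gamma)=K^\circ_{Y_0}(\Gamma)\rtimes\bigl(K^\circ_{Y_1}(\Gamma)\rtimes(\cdots\rtimes(K^\circ_{Y_{e-1}}(\Gamma)\rtimes K^\circ_{Y_e}(\Gamma))\cdots)\bigr).$$ If moreover $Y$ is saturated, then $K^\circ_{Y_e}(\Gamma)=\{\mathrm{Id}_{[S]}\}$.
   Context: $(W,S)$ is a right-angled Coxeter system (of arbitrary, possibly infinite, rank): $W$ is generated by the set $S$ of elements of order $2$, with $m_{s,t}\in\{1,2,\infty\}$ the order of $st$, and $W=\langle S\mid (st)^{m_{s,t}}=1,\ m_{s,t}\ne\infty\rangle$; $\Gamma=(m_{s,t})_{s,t\in S}$. For $X\subseteq S$, $C(X)=\{y\in S\mid \forall x\in X,\ xy=yx\}$, $C^2=C\circ C$, $C^2(s)=C^2(\{s\})$. The cells are the sets $C^2(s)$, $s\in S$; the kernel of $s$ is $N(s)=\{t\in S\mid C^2(t)=C^2(s)\}$; and $(C^2(s))^\star=C^2(s)\setminus N(s)=\{t\in S\mid C^2(t)\subsetneq C^2(s)\}$. $[S]$ is the $\mathbb F_2$-vector space of finite subsets of $S$ (addition $+$ is symmetric difference, basis the singletons), $[T]$ the subspace of finite subsets of $T\subseteq S$, $[S]_c$ the set of finite subsets of $S$ with pairwise commuting elements, $\mathrm{Aut}([S],[S]_c)$ the group of linear automorphisms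 $\varphi$ of $[S]$ with $\varphi([S]_c)=[S]_c$. $K(\Gamma)$ is the subgroup of $\varphi\in\mathrm{Aut}([S],[S]_c)$ with $\varphi([T])=[T]$ for every cell $T$. $K^\circ(\Gamma)=\{\varphi\in K(\Gamma)\mid\forall s\in S,\ \varphi(\{s\})\in\{s\}+[(C^2(s))^\star]\}$. The support of an endomorphism $\varphi$ of $[S]$ is $D_\varphi=\{s\in S\mid\varphi(\{s\})\ne\{s\}\}$; for $Y\subseteq S$, $K^\circ_Y(\Gamma)=\{\varphi\in K^\circ(\Gamma)\mid D_\varphi\subseteq Y\}$, a subgroup of $K^\circ(\Gamma)$. A chain of elements of $Y$ is a finite sequence $(y_0,\dots,y_p)$ in $Y$ with $C^2(y_{i-1})\subsetneq C^2(y_i)$ for $1\le i\le p$; its length is $p$ and its origin is $y_0$. For $y\in Y$, $p_Y(y)\in\mathbb N\cup\{\infty\}$ is the supremum of lengths of chains of elements of $Y$ with origin $y$, and $Y_p=\{y\in Y\mid p_Y(y)=p\}$. The thickness of $Y$ is the supremum in $\mathbb N\cup\{\infty\}$ of the function $p_Y$. $Y$ is saturated if $C^2(y)\subseteq Y$ for every $y\in Y$ (i.e. $Y$ is a union of cells). In $A\rtimes B$, $A$ is the normal factor. *)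

(* Defs.v *)
From HB Require Import structures.
From mathcomp Require Import all_boot all_algebra finmap.
From mathcomp Require Import boolp classical_sets.

Set Implicit Arguments.
Unset Strict Implicit.
Unset Printing Implicit Defensive.

Import GRing.Theory.

Local Open Scope classical_set_scope.
Local Open Scope group_scope.

(* N with infinity; [None] is infinity. *)
Definition natbar := option nat.

Definition natbar_le (x y : natbar) : Prop :=
  match x, y with
  | _, None => True
  | None, Some _ => False
  | Some m, Some n => (m <= n)%N
  end.

(* Supremum in N with infinity; in particular the supremum of the empty set
   is 0. *)
Definition natbar_sup (A : set natbar) : natbar :=
  match pselect (exists n, `[< forall x, A x -> natbar_le x (Some n) >]) with
  | left bounded => Some (ex_minn bounded)
  | right _ => None
  end.

Lemma natbar_sup_lub (A : set natbar) :
  (forall x, A x -> natbar_le x (natbar_sup A)) /\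
  (forall z, (forall x, A x -> natbar_le x z) -> natbar_le (natbar_sup A) z).
Proof.
rewrite /natbar_sup; case: pselect => [bnd|nbnd].
  case: ex_minnP => m /asboolP mub mmin; split=> // -[z|//] zub.
  by apply: mmin; apply/asboolP.
split=> [[] //|[z|//] zub]; case: nbnd; exists z; exact/asboolP.
Qed.

Section InfiniteGroups.
Variable G : groupType.
Implicit Types A B H N : set G.

Definition elt_order (x : G) : natbar :=
  match pselect (exists n, (0 < n)%N && (x ^+ n == 1)) with
  | left fin => Some (ex_minn fin)
  | right _ => None
  end.

Definition subgroup H : Prop := group_closed (mem H).

(* H is the internal semidirect product A ><| B, with A the normal factor. *)
Definition internal_sdprod H A B : Prop :=
  [/\ subgroup H, subgroup A & subgroup B] /\
  [/\ A `<=` H /\ B `<=` H,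
      forall h a, H h -> A a -> A (a ^ h),
      H = [set a * b | a in A & b in B]
    & A `&` B = [set 1]].

(* H = A 0 ><| (A 1 ><| (... ><| (A n.-1 ><| A n) ...)) *)
Fixpoint iterated_sdprod (n : nat) (A : nat -> set G) H : Prop :=
  if n is n'.+1 then
    exists2 B, iterated_sdprod n' (fun p => A p.+1) B
             & internal_sdprod H (A 0) B
  else subgroup H /\ H = A 0.

End InfiniteGroups.

(* The F_2-vector space of finite subsets of T. *)
Definition fpow (T : choiceType) : Type := {fset T}.

Section FinitePowerset.
Variable T : choiceType.
Local Open Scope fset_scope.

HB.instance Definition _ := Choice.copy (fpow T) {fset T}.

Definition symdiff (A B : fpow T) : fpow T := (A `\` B) `|` (B `\` A).

Lemma in_symdiff (A B : fpow T) x :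
  (x \in (symdiff A B : {fset T})) =
  (x \in (A : {fset T})) (+) (x \in (B : {fset T})).
Proof. by rewrite !inE; case: (x \in _); case: (x \in _). Qed.

Lemma symdiffA : associative symdiff.
Proof. by move=> A B C; apply/fsetP=> x; rewrite !in_symdiff addbA. Qed.

Lemma symdiffC : commutative symdiff.
Proof. by move=> A B; apply/fsetP=> x; rewrite !in_symdiff addbC. Qed.

Lemma symdiff0 : left_id (fset0 : fpow T) symdiff.
Proof. by move=> A; apply/fsetP=> x; rewrite in_symdiff in_fset0. Qed.

Lemma symdiffxx : left_inverse (fset0 : fpow T) id symdiff.
Proof. by move=> A; apply/fsetP=> x; rewrite in_symdiff addbb in_fset0. Qed.

HB.instance Definition _ :=
  GRing.isZmodule.Build (fpow T) symdiffA symdiffC symdiff0 symdiffxx.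

Local Open Scope ring_scope.

Definition fpow_scale (c : 'F_2) (A : fpow T) : fpow T :=
  if c == 0 then 0 else A.

Lemma F2_cases (c : 'F_2) : (c == 0) || (c == 1).
Proof. by case: c => [[|[|]]]. Qed.

Lemma fpow_addxx (A : fpow T) : A + A = 0.
Proof. exact: symdiffxx. Qed.

Lemma fpow_scaleA a b A :
  fpow_scale a (fpow_scale b A) = fpow_scale (a * b) A.
Proof. by rewrite /fpow_scale mulf_eq0; do 2!case: eqP. Qed.

Lemma fpow_scale1 : left_id 1 fpow_scale.
Proof. by move=> A; rewrite /fpow_scale oner_eq0. Qed.

Lemma fpow_scaleDr : right_distributive fpow_scale +%R.
Proof. by move=> a A B; rewrite /fpow_scale; case: eqP; rewrite ?addr0. Qed.

Lemma fpow_scaleDl A : {morph fpow_scale^~ A : a b / a + b}.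
Proof.
move=> a b; case/orP: (F2_cases a) => /eqP ->; case/orP: (F2_cases b) => /eqP ->;
  by rewrite /fpow_scale /= ?addr0 ?add0r // ?fpow_addxx.
Qed.

HB.instance Definition _ := GRing.Zmodule_isLmodule.Build 'F_2 (fpow T)
  fpow_scaleA fpow_scale1 fpow_scaleDr fpow_scaleDl.

Definition singleton (x : T) : fpow T := [fset x]%fset.

End FinitePowerset.

(* The group of linear automorphisms of V. *)
Record linaut (R : nzRingType) (V : lmodType R) := LinAut {
  linaut_fun :> V -> V;
  linaut_linear : linear linaut_fun;
  linaut_bij : bijective linaut_fun }.

Section LinearAutomorphisms.
Variables (R : nzRingType) (V : lmodType R).
Implicit Types f g : linaut V.

Lemma linaut_eqP f g : f =1 g -> f = g.
Proof.
case: f g => [f fl fb] [g gl gb] /= /funext fg; subst g.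
by rewrite (Prop_irrelevance fl gl) (Prop_irrelevance fb gb).
Qed.

HB.instance Definition _ := gen_eqMixin (linaut V).
HB.instance Definition _ := gen_choiceMixin (linaut V).

Lemma linaut_id_linear : linear (@id V).
Proof. by []. Qed.

Definition linaut_id : linaut V :=
  LinAut linaut_id_linear (Bijective (frefl _) (frefl _)).

Lemma linaut_comp_linear f g : linear (f \o g).
Proof. by move=> a u v /=; rewrite !linaut_linear. Qed.

Definition linaut_comp f g : linaut V :=
  LinAut (@linaut_comp_linear f g) (bij_comp (linaut_bij f) (linaut_bij g)).

Lemma linaut_inv_exists f : exists h : V -> V, cancel f h /\ cancel h f.
Proof. by have [g fK gK] := linaut_bij f; exists g. Qed.

Definition linaut_inv_fun f : V -> V := sval (cid (linaut_inv_exists f)).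

Lemma linaut_invK f : cancel f (linaut_inv_fun f).
Proof. by rewrite /linaut_inv_fun; case: cid => g []. Qed.

Lemma linaut_Kinv f : cancel (linaut_inv_fun f) f.
Proof. by rewrite /linaut_inv_fun; case: cid => g []. Qed.

Lemma linaut_inv_linear f : linear (linaut_inv_fun f).
Proof.
move=> a u v; apply: (can_inj (linaut_invK f)).
by rewrite linaut_linear !linaut_Kinv.
Qed.

Definition linaut_inv f : linaut V :=
  LinAut (@linaut_inv_linear f) (Bijective (linaut_Kinv f) (linaut_invK f)).

Lemma linaut_compA : associative linaut_comp.
Proof. by move=> f g h; apply: linaut_eqP. Qed.

Lemma linaut_comp1f : left_id linaut_id linaut_comp.
Proof. by move=> f; apply: linaut_eqP. Qed.

Lemma linaut_compf1 : right_id linaut_id linaut_comp.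
Proof. by move=> f; apply: linaut_eqP. Qed.

Lemma linaut_compVf : left_inverse linaut_id linaut_inv linaut_comp.
Proof. by move=> f; apply: linaut_eqP => x /=; rewrite linaut_invK. Qed.

Lemma linaut_compfV : right_inverse linaut_id linaut_inv linaut_comp.
Proof. by move=> f; apply: linaut_eqP => x /=; rewrite linaut_Kinv. Qed.

HB.instance Definition _ := isGroup.Build (linaut V)
  linaut_compA linaut_comp1f linaut_compf1 linaut_compVf linaut_compfV.

End LinearAutomorphisms.

(* A set S : set W is used below as the type of its elements; [val s : W] is
   the underlying element of s : S. *)
Section RightAngledCoxeter.
Variables (W : groupType) (S : set W).

Definition coxeter_matrix (s t : S) : natbar := elt_order (val s * val t).

(* The last field says that W, generated by S, is presented by the relations
   (st)^m_{s,t} = 1 with m_{s,t} finite, via the universal property. *)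
Record right_angled_coxeter_system : Prop := RightAngledCoxeterSystem {
  coxeter_order2 : forall s : S, elt_order (val s) = Some 2%N;
  coxeter_right_angled : forall s t : S,
    [\/ coxeter_matrix s t = Some 1%N, coxeter_matrix s t = Some 2%N
      | coxeter_matrix s t = None];
  coxeter_generated : forall H : set W, subgroup H -> S `<=` H -> H = setT;
  coxeter_presented : forall (G : groupType) (f : S -> G),
    (forall (s t : S) (m : nat),
        coxeter_matrix s t = Some m -> (f s * f t) ^+ m = 1) ->
    exists phi : {multiplicative W -> G}, forall s : S, phi (val s) = f s }.

Definition C (X : set S) : set S :=
  [set y | forall x, X x -> val x * val y = val y * val x].

Definition C2 (X : set S) : set S := C (C X).

Definition cell (s : S) : set S := C2 [set s].

Definition cells : set (set S) := [set cell s | s in [set: S]].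

Definition cell_kernel (s : S) : set S := [set t | cell t = cell s].

Definition cell_star (s : S) : set S := cell s `\` cell_kernel s.

Definition finite_subsets (T : set S) : set (fpow S) :=
  [set A | forall s, s \in (A : {fset S}) -> T s].

Definition commuting_subsets : set (fpow S) :=
  [set A | forall s t, s \in (A : {fset S}) -> t \in (A : {fset S}) ->
     val s * val t = val t * val s].

Definition Aut_c : set (linaut (fpow S)) :=
  [set phi | phi @` commuting_subsets = commuting_subsets].

Definition K : set (linaut (fpow S)) :=
  [set phi | Aut_c phi /\
    forall T, cells T -> phi @` finite_subsets T = finite_subsets T].

Definition Kcirc : set (linaut (fpow S)) :=
  [set phi | K phi /\
    forall s, exists2 A, finite_subsets (cell_star s) A
                       & phi (singleton s) = (singleton s + A)%R].

Definition supp (phi : fpow S -> fpow S) : set S :=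
  [set s | phi (singleton s) <> singleton s].

Definition Kcirc_on (Y : set S) : set (linaut (fpow S)) :=
  [set phi | Kcirc phi /\ supp phi `<=` Y].

(* (y, c_1, ..., c_p) is a chain of elements of Y, with c = [:: c_1; ...; c_p];
   its length is size c and its origin is y. *)
Definition chain (Y : set S) (y : S) (c : seq S) : Prop :=
  (forall z, z \in y :: c -> Y z) /\
  path (fun a b => `[< cell a `<` cell b >]) y c.

Definition height (Y : set S) (y : S) : natbar :=
  natbar_sup [set Some (size c) | c in chain Y y].

Definition layer (Y : set S) (p : nat) : set S :=
  [set y | Y y /\ height Y y = Some p].

Definition thickness (Y : set S) : natbar :=
  natbar_sup [set height Y y | y in Y].

Definition saturated (Y : set S) : Prop := forall y, Y y -> cell y `<=` Y.

End RightAngledCoxeter.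

(* Main.v *)
Require Import Defs.
From mathcomp Require Import all_boot all_algebra finmap.
From mathcomp Require Import boolp classical_sets.

(** Every [phi] in K° moves a generator [s] only by generators with strictly
    smaller cell, so if the cells of [Z] are maximal among those of [Y], each
    [phi] in K°_Y and its inverse preserve the finite subsets of the complement
    of [Z].  Hence replacing [phi] by the identity on [Z] gives again an element
    of K° (its inverse is the same modification of [phi^-1]), and
    K°_Y = K°_Z ><| K°_(Y \ Z).  The layers of [Y] are peeled off in this way,
    starting from [Y_0], which consists of the elements of [Y] whose cell is
    maximal. *)

Set Implicit Arguments.
Unset Strict Implicit.
Unset Printing Implicit Defensive.

Import GRing.Theory.

Local Open Scope classical_set_scope.

(** * Suprema in N with infinity *)

(** If [Some p] were missed, [p - 1] would already bound [A]; for [p = 0], a nonempty set bounded by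
    0 contains 0. Nonemptiness excludes the supremum 0 of the empty set. *)
Lemma natbar_sup_attained (A : set natbar) p :
  A !=set0 -> natbar_sup A = Some p -> A (Some p).
Proof.
move=> [x0 Ax0] supA; have [ub lub] := natbar_sup_lub A.
rewrite supA in ub lub; apply: contrapT => nAp.
case: p {supA} ub lub nAp => [|p] ub lub nAp.
  by case: x0 Ax0 (ub _ Ax0) => [[|m]|].
suff /lub : forall x, A x -> natbar_le x (Some p) by rewrite /= ltnn.
case=> [m|] Ax; have //= := ub _ Ax.
by rewrite leq_eqVlt => /orP[/eqP mp|//]; subst m.
Qed.

Local Open Scope ring_scope.

(** * Additive maps on finite powersets and their truncations *)

Section FinitePowersetMaps.
Variable T : choiceType.
Implicit Types (A B : fpow T) (D : set T).

Lemma in_fpowD A B x :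
  (x \in ((A + B : fpow T) : {fset T})) =
  (x \in (A : {fset T})) (+) (x \in (B : {fset T})).
Proof. exact: in_symdiff. Qed.

Lemma fpow_ind (P : fpow T -> Prop) A :
  P 0 -> (forall B B', P B -> P B' -> P (B + B')) ->
  (forall x, x \in (A : {fset T}) -> P (singleton x)) -> P A.
Proof.
move=> P0 PD; elim/fset1U_rect: A => [//|x A xA IH] Px.
(* Inserting a new element is adding its singleton, so every finite set is the sum of its
   singletons. *)
have -> : (x |` A)%fset = (singleton x + A : fpow T).
  apply/fsetP => y; rewrite in_fpowD /singleton !inE.
  by case: eqP => // ->; rewrite (negbTE xA).
apply: PD; first by apply: Px; rewrite !inE eqxx.
by apply: IH => y yA; apply: Px; rewrite !inE yA orbT.
Qed.

Lemma fpow_additive0 (f : fpow T -> fpow T) :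
  {morph f : A B / A + B} -> f 0 = 0.
Proof. by move=> fD; apply: (addIr (f 0)); rewrite -fD !add0r. Qed.

(** The only scalars are 0 and 1, so additivity suffices. *)
Lemma fpow_additive_linear (f : fpow T -> fpow T) :
  {morph f : A B / A + B} -> linear f.
Proof.
move=> fD a A B; rewrite fD; congr (_ + _).
case/orP: (F2_cases a) => /eqP ->; last by rewrite !scale1r.
by rewrite !scale0r fpow_additive0.
Qed.

Lemma linaut_fpowD (phi : linaut (fpow T)) : {morph phi : A B / A + B}.
Proof.
by move=> A B; have := linaut_linear phi 1 A B; rewrite !scale1r.
Qed.

Lemma fpow_additive_eq (f g : fpow T -> fpow T) A :
  {morph f : A B / A + B} -> {morph g : A B / A + B} ->
  (forall x, x \in (A : {fset T}) -> f (singleton x) = g (singleton x)) ->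
  f A = g A.
Proof.
move=> fD gD; apply: (fpow_ind (P := fun A => f A = g A)) => [|B B' eB eB'].
  by rewrite !fpow_additive0.
by rewrite fD gD eB eB'.
Qed.

Definition fpow_restr D A : fpow T := [fset x in (A : {fset T}) | `[< D x >]]%fset.

Lemma in_fpow_restr D A x :
  (x \in (fpow_restr D A : {fset T})) = (x \in (A : {fset T})) && `[< D x >].
Proof. by rewrite !inE. Qed.

Lemma fpow_restrD D : {morph fpow_restr D : A B / A + B}.
Proof.
move=> A B; apply/fsetP => x; rewrite in_fpowD !in_fpow_restr in_fpowD.
by case: asboolP; rewrite ?andbT ?andbF.
Qed.

Definition truncation D (f : fpow T -> fpow T) A : fpow T :=
  f (fpow_restr D A) + fpow_restr (~` D) A.

Lemma truncationD D f :
  {morph f : A B / A + B} -> {morph truncation D f : A B / A + B}.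
Proof. by move=> fD A B; rewrite /truncation !fpow_restrD fD addrACA. Qed.

Lemma truncation_in D f A : {morph f : A B / A + B} ->
  (forall x, x \in (A : {fset T}) -> D x) -> truncation D f A = f A.
Proof.
move=> fD AD; rewrite /truncation.
have -> : fpow_restr D A = A.
  apply/fsetP => x; rewrite in_fpow_restr.
  by case: (boolP (x \in _)) => //= /AD Dx; apply/asboolP.
have -> : fpow_restr (~` D) A = 0; last by rewrite addr0.
apply/fsetP => x; rewrite in_fpow_restr in_fset0.
by apply/negP => /andP[/AD Dx /asboolP].
Qed.

Lemma truncation_notin D f x : {morph f : A B / A + B} ->
  ~ D x -> truncation D f (singleton x) = singleton x.
Proof.
move=> fD nDx; rewrite /truncation.
have -> : fpow_restr D (singleton x) = 0.
  apply/fsetP => y; rewrite in_fpow_restr in_fset0 /singleton inE.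
  by apply/negP => /andP[/eqP -> /asboolP].
rewrite fpow_additive0 // add0r; apply/fsetP => y.
rewrite in_fpow_restr /singleton inE.
by case: eqP => //= ->; apply/asboolP.
Qed.

(** Singletons suffice. For [x] in [D] the image [f (singleton x)] stays in [[D]], where the
    truncated [g] is [g] itself; outside [D] both truncations fix [x]. *)
Lemma truncationK D (f g : fpow T -> fpow T) :
  {morph f : A B / A + B} -> {morph g : A B / A + B} ->
  (forall x, D x -> forall y, y \in (f (singleton x) : {fset T}) -> D y) ->
  cancel f g -> cancel (truncation D f) (truncation D g).
Proof.
move=> fD gD Df fK A; have tD := @truncationD D f fD.
have tgD := @truncationD D g gD.
apply: (@fpow_additive_eq (truncation D g \o truncation D f) id A) => //.
  by move=> B B' /=; rewrite tD tgD.
move=> x _ /=; have [Dx|nDx] := pselect (D x); last by rewrite !truncation_notin.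
have Dx1 y : y \in (singleton x : {fset T}) -> D y by rewrite inE => /eqP ->.
by rewrite (truncation_in fD Dx1) truncation_in //; apply: Df.
Qed.

End FinitePowersetMaps.

Section KernelGroups.
Variables (W : groupType) (S : set W).
Implicit Types (s t : S) (D Y Z : set S) (A B : fpow S).
Implicit Types (phi psi : linaut (fpow S)) (f g : fpow S -> fpow S).

(** * Cells and commutation *)

Lemma cell_refl s : cell s s.
Proof. by move=> x /(_ s erefl) ->. Qed.

(** Whatever commutes with [s] commutes with [t], so taking commutants once more reverses the
    inclusion. *)
Lemma cell_le s t : cell s t -> cell t `<=` cell s.
Proof.
by move=> st x tx z sz; apply: tx => _ ->; rewrite st.
Qed.

Lemma cell_starE s t : cell_star s t <-> cell t `<` cell s.
Proof.
split=> [[st ne]|[ts nst]].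
  split; first exact: cell_le.
  by move=> st'; apply: ne; apply/seteqP; split=> //; apply: cell_le.
split; first by apply: ts; apply: cell_refl.
by move=> /= ets; apply: nst; rewrite ets.
Qed.

Lemma cell_star_le s t : cell s t -> cell_star t `<=` cell_star s.
Proof.
move=> st x /cell_starE[xt ntx]; apply/cell_starE; split.
  exact: subset_trans xt (cell_le st).
by move=> sx; apply: ntx; apply: subset_trans sx; apply: cell_le.
Qed.

(** Two bicommutant steps: [t] lies in [C [set s]], so [x] commutes with [t]; then [x] lies in [C
    [set t]], so [y] commutes with [x]. *)
Lemma cell_commute s t x y : (val s * val t = val t * val s)%g ->
  cell s x -> cell t y -> (val x * val y = val y * val x)%g.
Proof. by move=> st sx; apply=> _ ->; apply: sx => _ ->. Qed.

(** * Unitriangular additive maps *)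

Lemma finite_subsets0 D : finite_subsets D 0.
Proof. by move=> s; rewrite in_fset0. Qed.

Lemma finite_subsetsD D A B :
  finite_subsets D A -> finite_subsets D B -> finite_subsets D (A + B).
Proof.
move=> DA DB s; rewrite in_fpowD.
by case: (boolP (s \in A)) => [/DA//|_] /= /DB.
Qed.

Lemma finite_subsets1 D s : D s -> finite_subsets D (singleton s).
Proof. by move=> Ds t; rewrite inE => /eqP ->. Qed.

Lemma finite_subsetsW D D' A :
  D `<=` D' -> finite_subsets D A -> finite_subsets D' A.
Proof. by move=> DD' DA s /DA /DD'. Qed.

Lemma finite_subsets_map D D' f A : {morph f : A B / A + B} ->
  (forall s, D s -> finite_subsets D' (f (singleton s))) ->
  finite_subsets D A -> finite_subsets D' (f A).
Proof.
move=> fD fDD' DA; apply: (fpow_ind (P := fun A => finite_subsets D' (f A))).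
- by rewrite fpow_additive0 //; apply: finite_subsets0.
- by move=> B B' fB fB'; rewrite fD; apply: finite_subsetsD.
- by move=> s /DA /fDD'.
Qed.

(** The condition that cuts [Kcirc] out of [K], stated for bare functions so that it also applies to
    truncations and inverses. *)
Definition unitriangular f : Prop :=
  forall s, exists2 A, finite_subsets (cell_star s) A
                     & f (singleton s) = singleton s + A.

Lemma unitriangular_id : unitriangular id.
Proof. by move=> s; exists 0; rewrite ?addr0 //; apply: finite_subsets0. Qed.

(** Over F_2, [f A + A] is the value of [f - id], which strictly lowers the cell of each
    singleton. *)
Lemma unitriangular_diff f A s : {morph f : A B / A + B} -> unitriangular f ->
  finite_subsets (cell s) A -> finite_subsets (cell_star s) (f A + A).
Proof.
move=> fD fU.
apply: (finite_subsets_map (f := fun A => f A + A)) => [B B'|t st].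
  by rewrite fD addrACA.
have [B tB ->] := fU t; rewrite addrAC fpow_addxx add0r.
exact: finite_subsetsW (cell_star_le st) tB.
Qed.

Lemma unitriangular_saturated f D A : {morph f : A B / A + B} ->
  unitriangular f -> saturated D ->
  finite_subsets D A -> finite_subsets D (f A).
Proof.
move=> fD fU satD; apply: finite_subsets_map => // s Ds.
have [B sB ->] := fU s; apply: finite_subsetsD; first exact: finite_subsets1.
by apply: finite_subsetsW sB => t [st _]; apply: (satD s Ds).
Qed.

Lemma saturated_cell s : saturated (cell s).
Proof. by move=> t; apply: cell_le. Qed.

Lemma saturated_cell_star s : saturated (cell_star s).
Proof.
move=> t st x tx; apply/cell_starE; case/cell_starE: st => ts nst; split.
  exact: subset_trans (cell_le tx) ts.
by move=> sx; apply: nst; apply: subset_trans sx _; apply: cell_le.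
Qed.

Lemma unitriangular_comp f g : {morph f : A B / A + B} ->
  unitriangular f -> unitriangular g -> unitriangular (f \o g).
Proof.
move=> fD fU gU s; have [A sA gs] := gU s; have [B sB fs] := fU s.
exists (B + f A); last by rewrite /= gs fD fs addrA.
apply: finite_subsetsD => //.
exact: unitriangular_saturated (@saturated_cell_star s) sA.
Qed.

Lemma unitriangular_commuting f A : {morph f : A B / A + B} ->
  unitriangular f -> commuting_subsets A -> commuting_subsets (f A).
Proof.
move=> fD fU cA.
(* The union of the cells of elements of [A] is saturated and contains [A], hence contains [f A];
   [cell_commute] then applies to any two of its elements. *)
have fA : finite_subsets [set t | exists2 s, s \in (A : {fset S}) & cell s t]
    (f A).
  apply: (unitriangular_saturated fD fU).
    by move=> t [s sA st] x tx; exists s => //; apply: cell_le tx.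
  by move=> s sA; exists s => //; apply: cell_refl.
by move=> x y /fA[s sA sx] /fA[t tA ty]; apply: (@cell_commute s t) => //; apply: cA.
Qed.

(** * Membership in K° and its subgroups *)

Lemma Kcirc_unitriangular phi g : {morph g : A B / A + B} -> cancel g phi ->
  unitriangular phi -> unitriangular g -> Kcirc phi.
Proof.
move=> gD gK phiU gU.
(* Unitriangularity of [phi] gives only the inclusion of the image in [X]; the reverse inclusion
   comes from the inverse [g]. *)
have stable (X : set (fpow S)) : (forall f A, {morph f : A B / A + B} -> unitriangular f ->
    X A -> X (f A)) -> phi @` X = X.
  move=> stX; apply/seteqP; split=> [_ [A XA <-]|A XA].
    exact: stX (@linaut_fpowD _ phi) phiU XA.
  by exists (g A); [apply: stX | apply: gK].
split=> //; split; first by apply: stable => f A; apply: unitriangular_commuting.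
move=> _ [s _ <-]; apply: stable => f A fD fU.
exact: unitriangular_saturated (@saturated_cell s).
Qed.

Lemma Kcirc_inv_unitriangular phi : Kcirc phi -> unitriangular (phi^-1)%g.
Proof.
move=> [[_ phiC] phiU] s; set v := (phi^-1)%g (singleton s).
have phiv : phi v = singleton s by apply: linaut_Kinv.
(* As [phi] maps [[cell s]] onto itself, the preimage [v] of [singleton s] already lies there, even
   if the cell is infinite. *)
have vs : finite_subsets (cell s) v.
  have := finite_subsets1 (@cell_refl s).
  rewrite -{1}(phiC (cell s)); last by exists s.
  move=> [u su us]; have -> : v = u; last exact: su.
  by rewrite /v -us; apply: linaut_invK.
(* The witness is [phi v + v], which [unitriangular_diff] places in [[cell_star s]]. *)
exists (singleton s + v); last by rewrite addrA fpow_addxx add0r.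
by rewrite -phiv; apply: unitriangular_diff => //; apply: linaut_fpowD.
Qed.

Lemma Kcirc1 : Kcirc (1%g : linaut (fpow S)).
Proof.
by apply: (@Kcirc_unitriangular _ id) => //; apply: unitriangular_id.
Qed.

Lemma KcircV phi : Kcirc phi -> Kcirc (phi^-1)%g.
Proof.
move=> Kphi; apply: (@Kcirc_unitriangular _ phi).
- exact: linaut_fpowD.
- exact: linaut_invK.
- exact: Kcirc_inv_unitriangular.
- by case: Kphi.
Qed.

Lemma KcircM phi psi : Kcirc phi -> Kcirc psi -> Kcirc (phi * psi)%g.
Proof.
move=> Kphi Kpsi; apply: (@Kcirc_unitriangular _ (psi^-1 * phi^-1)%g).
- exact: linaut_fpowD.
- by move=> A /=; rewrite !linaut_Kinv.
- apply: unitriangular_comp; first exact: linaut_fpowD.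
    by case: Kphi.
  by case: Kpsi.
- by apply: unitriangular_comp; [apply: linaut_fpowD | |];
    apply: Kcirc_inv_unitriangular.
Qed.

Lemma suppP f Y :
  supp f `<=` Y <-> forall s, ~ Y s -> f (singleton s) = singleton s.
Proof.
split=> [fY s nYs|fY s fs]; apply: contrapT.
  by move=> /fY.
by move=> /fY.
Qed.

Lemma subgroup_Kcirc_on Y : subgroup (Kcirc_on Y).
Proof.
split; first by rewrite inE; split; [apply: Kcirc1|apply/suppP].
move=> phi psi; rewrite !inE => -[Kphi /suppP Yphi] [Kpsi /suppP Ypsi].
split; first by apply: KcircM => //; apply: KcircV.
apply/suppP => s nYs /=.
by rewrite -{1}(Ypsi s nYs) linaut_invK Yphi.
Qed.

Lemma Kcirc_onW Y Z : Z `<=` Y -> Kcirc_on Z `<=` Kcirc_on Y.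
Proof. by move=> ZY phi [Kphi Zphi]; split=> // s /Zphi /ZY. Qed.

Lemma Kcirc_onV Y phi : Kcirc_on Y phi -> Kcirc_on Y (phi^-1)%g.
Proof.
have := group_closedV (subgroup_Kcirc_on Y) => /(_ phi).
by rewrite !inE.
Qed.

Lemma linaut_fpow1 phi : (forall s, phi (singleton s) = singleton s) ->
  phi = 1%g.
Proof.
move=> phi1; apply: linaut_eqP => A.
by apply: (fpow_additive_eq (g := id)) => //; apply: linaut_fpowD.
Qed.

(** * Splitting off a set of maximal cells *)

Section Split.
Variables (Y Z : set S).
Hypothesis ZY : Z `<=` Y.
Hypothesis Zmax : forall s t, Y s -> Z t -> ~ cell t `<` cell s.

(** A generator outside [Y] is fixed; one in [Y] but not in [Z] is changed only by generators of
    strictly smaller cell, which [Zmax] keeps out of [Z]. *)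
Lemma Kcirc_on_stable phi A : Kcirc_on Y phi ->
  finite_subsets (~` Z) A -> finite_subsets (~` Z) (phi A).
Proof.
move=> [[_ phiU] /suppP phiY].
apply: finite_subsets_map; first exact: linaut_fpowD.
move=> s nZs; have [Ys|nYs] := pselect (Y s); last first.
  by rewrite phiY //; apply: finite_subsets1.
have [B sB ->] := phiU s; apply: finite_subsetsD; first exact: finite_subsets1.
by apply: finite_subsetsW sB => t /cell_starE ts Zt; apply: Zmax ts.
Qed.

Lemma Kcirc_on_truncationK phi : Kcirc_on Y phi ->
  cancel (truncation (~` Z) phi) (truncation (~` Z) (phi^-1)%g).
Proof.
move=> Yphi; apply: truncationK; try exact: linaut_fpowD.
  by move=> s nZs; apply: Kcirc_on_stable => //; apply: finite_subsets1.
exact: linaut_invK.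
Qed.

Lemma truncation_unitriangular phi :
  unitriangular phi -> unitriangular (truncation (~` Z) phi).
Proof.
move=> phiU s; have phiD := @linaut_fpowD _ phi.
have [Zs|nZs] := pselect (Z s).
  rewrite truncation_notin //; exact: unitriangular_id.
by rewrite truncation_in //; exact: finite_subsets1.
Qed.

Lemma truncation_Kcirc phi : Kcirc_on Y phi ->
  exists2 psi, Kcirc_on (Y `\` Z) psi & psi =1 truncation (~` Z) phi.
Proof.
move=> Yphi; have phiD := @linaut_fpowD _ phi.
have phiVD := @linaut_fpowD _ (phi^-1)%g.
have tK := Kcirc_on_truncationK Yphi.
have tVK := Kcirc_on_truncationK (Kcirc_onV Yphi); rewrite invgK in tVK.
pose psi := LinAut (fpow_additive_linear (@truncationD _ (~` Z) _ phiD))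
  (Bijective tK tVK).
exists psi => //; split.
  have phiU : unitriangular phi by case: Yphi => -[].
  have phiVU := Kcirc_inv_unitriangular (proj1 Yphi).
  exact: (@Kcirc_unitriangular psi _ (@truncationD _ (~` Z) _ phiVD) tVK
    (truncation_unitriangular phiU) (truncation_unitriangular phiVU)).
apply/suppP => s nYZ /=; have [Zs|nZs] := pselect (Z s).
  by rewrite truncation_notin.
rewrite truncation_in //; last exact: finite_subsets1.
by case: Yphi => _ /suppP; apply => Ys; apply: nYZ.
Qed.

Lemma Kcirc_on_fix phi A :
  Kcirc_on Z phi -> finite_subsets (~` Z) A -> phi A = A.
Proof.
move=> [_ /suppP Zphi] nA.
apply: (fpow_additive_eq (g := id)) => //; first exact: linaut_fpowD.
by move=> s /nA /Zphi.
Qed.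

Lemma Kcirc_on_sdprod :
  internal_sdprod (Kcirc_on Y) (Kcirc_on Z) (Kcirc_on (Y `\` Z)).
Proof.
have sub := subgroup_Kcirc_on; have YZY : Y `\` Z `<=` Y by move=> s [].
split; first by split; apply: sub.
split.
- by split; apply: Kcirc_onW.
- move=> phi psi Yphi Zpsi; split.
    apply: KcircM; first by apply: KcircV; case: Yphi.
    by apply: KcircM; [case: Zpsi | case: Yphi].
  apply/suppP => s nZs /=.
  (* Off [Z], the conjugate acts by [phi], [psi], [phi^-1] in turn: [phi] stays off [Z], where [psi]
     is the identity, and [phi^-1] undoes [phi]. *)
  rewrite (Kcirc_on_fix Zpsi) ?linaut_invK //.
  by apply: Kcirc_on_stable => //; apply: finite_subsets1.
- apply/seteqP; split=> [phi Yphi|_ [phi Zphi [psi YZpsi <-]]]; last first.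
    have := group_closedM (sub Y) => /(_ phi psi); rewrite !inE; apply.
      exact: Kcirc_onW Zphi.
    exact: Kcirc_onW YZpsi.
  have [psi YZpsi psiE] := truncation_Kcirc Yphi.
  (* With [psi] the truncation of [phi], the quotient is the factor expected to be supported in
     [Z]. *)
  exists (phi * psi^-1)%g; last by exists psi => //; rewrite mulgVK.
  split.
    by apply: KcircM; [case: Yphi | apply: KcircV; case: YZpsi].
  apply/suppP => s nZs.
  have YpsiV := Kcirc_onV (Kcirc_onW YZY YZpsi).
  (* For [s] off [Z], [psi^-1] sends [s] to a set avoiding [Z], on which [phi] and [psi] agree; so
     the quotient fixes [s]. *)
  have nZV := Kcirc_on_stable YpsiV (finite_subsets1 (D := ~` Z) nZs).
  rewrite /= -[LHS](truncation_in (@linaut_fpowD _ phi) nZV) -psiE.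
  exact: linaut_Kinv.
- apply/seteqP; split=> [phi [[_ /suppP Zphi] [_ /suppP YZphi]]|_ ->].
    apply: linaut_fpow1 => s; have [Zs|] := pselect (Z s); last exact: Zphi.
    by apply: YZphi => -[].
  by split; [have [] := sub Z | have [] := sub (Y `\` Z)]; rewrite inE.
Qed.

End Split.

(** * Heights, layers and the iterated decomposition *)

Lemma chain_nil Y s : Y s -> chain Y s [::].
Proof. by move=> Ys; split=> // t; rewrite inE => /eqP ->. Qed.

Lemma height_attained Y s p :
  Y s -> height Y s = Some p -> exists2 c, chain Y s c & size c = p.
Proof.
move=> Ys /natbar_sup_attained[|c Yc [<-]]; last by exists c.
by exists (Some 0%N); exists [::] => //; apply: chain_nil.
Qed.

(** Chains ascend from their origin, so putting [t] before a longest chain from [s] gives one of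
    length [p + 1] from [t]: smaller cells have larger height. *)
Lemma height_lt Y s t p q : Y s -> Y t -> cell t `<` cell s ->
  height Y s = Some p -> height Y t = Some q -> (p < q)%N.
Proof.
move=> Ys Yt ts /(height_attained Ys)[c [Yc pc] <-] tq.
have := (natbar_sup_lub [set Some (size c) | c in chain Y t]).1
  (Some (size (s :: c))).
rewrite -/(height Y t) tq; apply; exists (s :: c) => //; split.
  by move=> x; rewrite inE => /orP[/eqP ->//|]; apply: Yc.
by rewrite /= pc andbT; apply/asboolP.
Qed.

Lemma height_thickness Y e s : thickness Y = Some e -> Y s ->
  exists2 p, height Y s = Some p & (p <= e)%N.
Proof.
move=> Ye Ys.
have := (natbar_sup_lub [set height Y y | y in Y]).1 (height Y s).
rewrite -/(thickness Y) Ye => /(_ (ex_intro2 _ _ s Ys erefl)).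
by case: (height Y s) => [p|//] pe; exists p.
Qed.

(** What remains of [Y] after the layers of index below [k] have been peeled off, elements of
    infinite height being excluded. *)
Definition upper_layers Y k : set S :=
  [set s | Y s /\ exists2 p, height Y s = Some p & (k <= p)%N].

Lemma upper_layersD Y k :
  upper_layers Y k `\` layer Y k = upper_layers Y k.+1.
Proof.
apply/seteqP; split=> s /=.
  move=> [[Ys [p sp kp]] nk]; split=> //; exists p => //.
  by rewrite ltn_neqAle kp andbT; apply/eqP => kp'; apply: nk; subst k.
move=> [Ys [p sp kp]]; split; first by split=> //; exists p => //; apply: ltnW.
by move=> [_]; rewrite sp => -[pk]; rewrite pk ltnn in kp.
Qed.

Lemma Kcirc_on_upper_sdprod Y k : internal_sdprod (Kcirc_on (upper_layers Y k))
  (Kcirc_on (layer Y k)) (Kcirc_on (upper_layers Y k.+1)).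
Proof.
rewrite -upper_layersD; apply: Kcirc_on_sdprod.
  by move=> s [Ys sk]; split=> //; exists k.
(* A cell strictly above that of [t] would have height below [k], so layer [k] is maximal in what
   remains. *)
move=> s t [Ys [p sp kp]] [Yt tk] ts.
by have := height_lt Ys Yt ts sp tk; rewrite ltnNge kp.
Qed.

Lemma Kcirc_on_iterated Y n k : thickness Y = Some (k + n)%N ->
  iterated_sdprod n (fun p => Kcirc_on (layer Y (k + p)))
    (Kcirc_on (upper_layers Y k)).
Proof.
elim: n k => [|n IH] k Ye.
  split; first exact: subgroup_Kcirc_on.
  (* Here [k] is the thickness, so heights at least [k] equal [k] and only the last layer is
     left. *)
  rewrite addn0; congr Kcirc_on; apply/seteqP; split=> s [Ys].
    move=> [p sp kp]; split=> //; rewrite sp.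
    have [q] := height_thickness Ye Ys; rewrite sp addn0 => -[<-] pk.
    by congr Some; apply/eqP; rewrite eqn_leq pk.
  by move=> sk; split=> //; exists k.
exists (Kcirc_on (upper_layers Y k.+1)); last first.
  by rewrite addn0; apply: Kcirc_on_upper_sdprod.
rewrite (_ : (fun p => _) = fun p => Kcirc_on (layer Y (k.+1 + p))).
  by apply: IH; rewrite addSnnS.
by apply: funext => p; rewrite addSnnS.
Qed.

Lemma upper_layers0 Y e : thickness Y = Some e -> upper_layers Y 0 = Y.
Proof.
move=> Ye; apply/seteqP; split=> s; first by case.
by move=> Ys; split=> //; have [p sp _] := height_thickness Ye Ys; exists p.
Qed.

Lemma Kcirc_on_top_layer Y e : thickness Y = Some e -> saturated Y ->
  Kcirc_on (layer Y e) = [set 1%g].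
Proof.
move=> Ye satY; apply/seteqP; split=> [phi [[_ phiU] /suppP phie]|_ ->].
  apply: linaut_fpow1 => s; have [[Ys se]|] := pselect (layer Y e s).
    (* An element of [A] would lie in [Y] by saturation and have a cell strictly below that of [s],
       hence height above [e]. *)
    have [A sA ->] := phiU s; suff -> : A = 0 by rewrite addr0.
    apply/fsetP => t; rewrite in_fset0; apply/negP => /sA st.
    have Yt : Y t by case: st => st _; apply: satY st.
    have [p tp] := height_thickness Ye Yt.
    have := height_lt Ys Yt ((cell_starE s t).1 st) se tp.
    by rewrite ltnNge => /negP.
  exact: phie.
by have [] := subgroup_Kcirc_on (layer Y e); rewrite inE.
Qed.

End KernelGroups.

Theorem mainTheorem3 (W : groupType) (S : set W)
    (hWS : right_angled_coxeter_system S)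
    (Y : set S) (e : nat) (hY : thickness Y = Some e) :
  iterated_sdprod e (fun p => Kcirc_on (layer Y p)) (Kcirc_on Y) /\
  (saturated Y -> Kcirc_on (layer Y e) = [set 1%g]%classic).
Proof.
split; last exact: Kcirc_on_top_layer.
have := @Kcirc_on_iterated W S Y e 0 hY.
by rewrite (upper_layers0 hY).
Qed.
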